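(* Let $A$ be an algebra in $\mathcal{V}$ such that $K(A)$ is closed under the commutator operation. Consider the properties: (1) $A$ is a $PP$-algebra; (2) the reticulation $L(A)$ is a Stone lattice. Then the implication $(1)\Rightarrow(2)$ holds; if $A$ is semiprime, then the converse implication $(2)\Rightarrow(1)$ holds.
   Context: $\mathcal{V}$ is a fixed congruence-modular variety of algebras (of a finite signature) that is semidegenerate: no nontrivial algebra in $\mathcal{V}$ has one-element subalgebras (equivalently, $\nabla_A$ is compact in $Con(A)$ for every $A\in\mathcal{V}$). For $A\in\mathcal{V}$, $Con(A)$ is the complete lattice of congruences of $A$, with least element $\Delta_A$ and greatest element $\nabla_A$; $K(A)$ is the set of compact (= finitely generated) congruences and $PCon(A)$ the set of principal congruences. $B(Con(A))$ is the set of complemented elements of $Con(A)$. Commutator: $[\cdot,\cdot]=[\cdot,\cdot]_A$ is the (modular) commutator, i.e. the greatest operation on the congruence lattices of members of $\mathcal{V}$ such that for every surjective morphism $f:A\to B$ in $\mathcal{V}$ and all $\alpha,\beta\in Con(A)$: $[\alpha,\beta]_A\subseteq\alpha\cap\beta$ and $[\alpha,\beta]_A\vee Ker(f)=f^{-1}([f(\alpha\vee Ker(f)),f(\beta\vee Ker(f))]_B)$. Put $\alpha^{\perp}=\bigvee\{\gamma\in Con(A)\mid[\alpha,\gamma]=\Delta_A\}$. $\phi\in Con(A)\setminus\{\nabla_A\}$ is prime if $[\alpha,\beta]\subseteq\phi$ implies $\alpha\subseteq\phi$ or $\beta\subseteq\phi$ (for $\alpha,\beta\in Con(A)$); $Spec(A)$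 is the set of prime congruences; $\rho(\theta)=\bigcap\{\phi\in Spec(A)\mid\theta\subseteq\phi\}$; $A$ is semiprime if $\rho(\Delta_A)=\Delta_A$. Reticulation: when $K(A)$ is closed under the commutator, $L(A)=K(A)/{\equiv}$ where $\alpha\equiv\beta$ iff $\rho(\alpha)=\rho(\beta)$; $\lambda_A:K(A)\to L(A)$ is the quotient map; $L(A)$ is a bounded distributive lattice with $\lambda_A(\alpha)\vee\lambda_A(\beta)=\lambda_A(\alpha\vee\beta)$, $\lambda_A(\alpha)\wedge\lambda_A(\beta)=\lambda_A([\alpha,\beta])$, $0=\lambda_A(\Delta_A)$, $1=\lambda_A(\nabla_A)$. $A$ is a $PP$-algebra if $\alpha^{\perp}\in B(Con(A))$ for every $\alpha\in PCon(A)$. For a bounded distributive lattice $L$, $B(L)$ is the Boolean algebra of complemented elements, $(e]=\{y\in L\mid y\leq e\}$, $Ann(x)=\{y\in L\mid x\wedge y=0\}$; $L$ is a Stone lattice if for each $x\in L$ there exists $e\in B(L)$ with $Ann(x)=(e]$. *)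

(* Defs.v *)
From HB Require Import structures.
From mathcomp Require Import all_boot all_order.
From mathcomp Require Import boolp classical_sets.

Set Implicit Arguments.
Unset Strict Implicit.
Unset Printing Implicit Defensive.

Import Order.TTheory.
Local Open Scope order_scope.
Local Open Scope quotient_scope.
#[local] Obligation Tactic := idtac.

Definition modular_lattice d (L : latticeType d) : Prop :=
  forall x y z : L, x <= z -> x `|` (y `&` z) = (x `|` y) `&` z.

Definition complemented d (L : tbLatticeType d) (x : L) : Prop :=
  exists y : L, x `&` y = \bot /\ x `|` y = \top.

Definition annihilator d (L : tbDistrLatticeType d) (x : L) : set L :=
  fun y => x `&` y = \bot.

Definition principal_ideal d (L : tbDistrLatticeType d) (e : L) : set L :=
  fun y => y <= e.

Definition stone_lattice d (L : tbDistrLatticeType d) : Prop :=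
  forall x : L, exists e : L,
    complemented e /\ annihilator x = principal_ideal e.

Record signature := Signature { symbol : finType; arity : symbol -> nat }.

(* As usual in universal algebra, carriers are nonempty. *)
Record algebra (sg : signature) := Algebra {
  carrier :> Type;
  oper : forall s : symbol sg, ('I_(arity s) -> carrier) -> carrier;
  carrier_inhabited : inhabited carrier }.

Record hom (sg : signature) (A B : algebra sg) := Hom {
  hom_fun :> A -> B;
  hom_oper : forall (s : symbol sg) (x : 'I_(arity s) -> A),
    hom_fun (oper x) = oper (fun i => hom_fun (x i)) }.

Definition surjective (sg : signature) (A B : algebra sg) (f : hom A B) :=
  forall b : B, exists a : A, f a = b.

Definition subuniverse (sg : signature) (A : algebra sg) (X : set A) : Prop :=
  forall (s : symbol sg) (x : 'I_(arity s) -> A),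
    (forall i, X (x i)) -> X (oper x).

Section Constructions.
Variable sg : signature.

Section Subalgebra.
Variables (A : algebra sg) (X : set A).
Hypotheses (subX : subuniverse X) (X0 : exists a, X a).

Definition sub_oper (s : symbol sg) (x : 'I_(arity s) -> {a : A | X a}) :
    {a : A | X a} :=
  exist _ (oper (fun i => sval (x i))) (subX (fun i => svalP (x i))).

Lemma sub_inhabited : inhabited {a : A | X a}.
Proof. by case: X0 => a Xa; split; exists a. Qed.

Definition subalgebra := Algebra sub_oper sub_inhabited.
End Subalgebra.

Section Product.
Variables (I : Type) (F : I -> algebra sg).

Lemma prod_inhabited : inhabited (forall i, F i).
Proof. by split=> i; apply: inhabited_witness; apply: carrier_inhabited. Qed.

Definition product_algebra :=
  @Algebra sg (forall i, F i) (fun s x i => oper (fun j => x j i))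
    prod_inhabited.
End Product.
End Constructions.

Record variety (sg : signature) (V : algebra sg -> Prop) : Prop := Variety {
  variety_image : forall (A B : algebra sg) (f : hom A B),
    surjective f -> V A -> V B;
  variety_sub : forall (A : algebra sg) (X : set A)
    (subX : subuniverse X) (X0 : exists a, X a), V A -> V (subalgebra subX X0);
  variety_prod : forall (I : Type) (F : I -> algebra sg),
    (forall i, V (F i)) -> V (product_algebra F) }.

Definition trivial_algebra (sg : signature) (A : algebra sg) : Prop :=
  forall x y : A, x = y.

Definition semidegenerate (sg : signature) (V : algebra sg -> Prop) : Prop :=
  forall A : algebra sg, V A -> ~ trivial_algebra A ->
    ~ exists a : A, subuniverse [set a]%classic.

Record congruence (sg : signature) (A : algebra sg) := Congruence {
  cong_rel :> A -> A -> Prop;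
  cong_refl : forall x, cong_rel x x;
  cong_sym : forall x y, cong_rel x y -> cong_rel y x;
  cong_trans : forall x y z, cong_rel x y -> cong_rel y z -> cong_rel x z;
  cong_oper : forall (s : symbol sg) (x y : 'I_(arity s) -> A),
    (forall i, cong_rel (x i) (y i)) -> cong_rel (oper x) (oper y) }.

Section CongruenceLattice.
Variables (sg : signature) (A : algebra sg).
Implicit Types (R : A -> A -> Prop) (S : set (congruence A)).
Implicit Types (a b t : congruence A).

Lemma congruence_ext a b : (forall x y, a x y <-> b x y) -> a = b.
Proof.
case: a b => [r r1 r2 r3 r4] [q q1 q2 q3 q4] /= rq.
have e : r = q by apply/funext => x; apply/funext => y; apply/propext; exact: rq.
by case: q / e q1 q2 q3 q4 {rq} => q1 q2 q3 q4; congr Congruence;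
  exact: Prop_irrelevance.
Qed.

HB.instance Definition _ := gen_eqMixin (congruence A).
HB.instance Definition _ := gen_choiceMixin (congruence A).

Definition cong_le a b : bool := `[< forall x y, a x y -> b x y >].

Program Definition cong_inf S : congruence A :=
  @Congruence sg A (fun x y => forall t, S t -> t x y) _ _ _ _.
Next Obligation. by move=> S x t _; apply: cong_refl. Qed.
Next Obligation. by move=> S x y h t St; apply: cong_sym; apply: h. Qed.
Next Obligation.
by move=> S x y z h k t St; apply: (cong_trans (h t St) (k t St)).
Qed.
Next Obligation.
by move=> S s x y h t St; apply: cong_oper => i; apply: h.
Qed.

Definition cong_gen R : congruence A :=
  cong_inf [set t | forall x y, R x y -> t x y]%classic.

Definition cong_sup S : congruence A :=
  cong_gen (fun x y => exists2 t, S t & t x y).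

Program Definition cong_bot : congruence A := @Congruence sg A eq _ _ _ _.
Next Obligation. by []. Qed.
Next Obligation. by move=> x y ->. Qed.
Next Obligation. by move=> x y z -> ->. Qed.
Next Obligation. by move=> s x y h; congr oper; apply/funext. Qed.

Definition cong_top : congruence A :=
  @Congruence sg A (fun _ _ => True) (fun _ => I) (fun _ _ _ => I)
    (fun _ _ _ _ _ => I) (fun _ _ _ _ => I).

Program Definition cong_meet a b : congruence A :=
  @Congruence sg A (fun x y => a x y /\ b x y) _ _ _ _.
Next Obligation. by move=> a b x; split; apply: cong_refl. Qed.
Next Obligation. by move=> a b x y [h k]; split; apply: cong_sym. Qed.
Next Obligation.
move=> a b x y z [h k] [h' k'].
by split; [apply: cong_trans h h'|apply: cong_trans k k'].
Qed.
Next Obligation.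
by move=> a b s x y h; split; apply: cong_oper => i; case: (h i).
Qed.

Definition cong_join a b : congruence A :=
  cong_gen (fun x y => a x y \/ b x y).

Lemma cong_le_refl : reflexive cong_le.
Proof. by move=> a; apply/asboolP. Qed.

Lemma cong_le_anti : antisymmetric cong_le.
Proof.
move=> a b /andP[/asboolP h /asboolP k].
by apply: congruence_ext => x y; split; [apply: h|apply: k].
Qed.

Lemma cong_le_trans : transitive cong_le.
Proof.
by move=> a b c /asboolP h /asboolP k; apply/asboolP => x y /h /k.
Qed.

Fact cong_display : Order.disp_t. Proof. exact: Order.Disp tt tt. Qed.

HB.instance Definition _ := Order.Le_isPOrder.Build cong_display
  (congruence A) cong_le_refl cong_le_anti cong_le_trans.

Lemma cong_leP a b : reflect (forall x y, a x y -> b x y) (a <= b).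
Proof. exact: asboolP. Qed.

Lemma cong_genP R b : reflect (forall x y, R x y -> b x y) (cong_gen R <= b).
Proof.
apply: (iffP (cong_leP _ _)) => [h x y Rxy|h x y]; last exact.
by apply: h => t; apply.
Qed.

Lemma cong_meetP a b c :
  (a <= cong_meet b c) = (a <= b) && (a <= c).
Proof.
apply/cong_leP/andP => [h|[/cong_leP h /cong_leP k] x y axy].
  by split; apply/cong_leP => x y /h[].
by split; [apply: h|apply: k].
Qed.

Lemma cong_joinP a b c :
  (cong_join a b <= c) = (a <= c) && (b <= c).
Proof.
apply/cong_genP/andP => [h|[/cong_leP h /cong_leP k] x y [/h|/k]//].
by split; apply/cong_leP => x y ?; apply: h; [left|right].
Qed.

HB.instance Definition _ := Order.POrder_MeetJoin_isLattice.Build cong_display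
  (congruence A) cong_meetP cong_joinP.

Lemma cong_le0 a : cong_bot <= a.
Proof. by apply/cong_leP => x _ <-; apply: cong_refl. Qed.

Lemma cong_le1 a : a <= cong_top.
Proof. exact/cong_leP. Qed.

HB.instance Definition _ :=
  Order.hasBottom.Build cong_display (congruence A) cong_le0.
HB.instance Definition _ :=
  Order.hasTop.Build cong_display (congruence A) cong_le1.

Lemma cong_supP S b : (cong_sup S <= b) <-> (forall t, S t -> t <= b).
Proof.
split=> [/cong_genP h t St|h].
  by apply/cong_leP => x y txy; apply: h; exists t.
by apply/cong_genP => x y [t /h /cong_leP]; apply.
Qed.

Definition compact a : Prop := forall S : set (congruence A),
  a <= cong_sup S ->
  exists l : seq (congruence A),
    (forall t, t \in l -> S t) /\ a <= \join_(t <- l) t.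

Definition principal a : Prop :=
  exists u v : A, a = cong_gen (fun x y => x = u /\ y = v).

End CongruenceLattice.

Definition congruence_modular (sg : signature) (V : algebra sg -> Prop) :=
  forall A : algebra sg, V A -> modular_lattice (congruence A).

Section Homomorphisms.
Variables (sg : signature) (A B : algebra sg) (f : hom A B).

Program Definition cong_preim (b : congruence B) : congruence A :=
  @Congruence sg A (fun x y => b (f x) (f y)) _ _ _ _.
Next Obligation. by move=> b x; apply: cong_refl. Qed.
Next Obligation. by move=> b x y; apply: cong_sym. Qed.
Next Obligation. by move=> b x y z; apply: cong_trans. Qed.
Next Obligation. by move=> b s x y h /=; rewrite !hom_oper; apply: cong_oper. Qed.

Definition cong_ker : congruence A := cong_preim \bot.

Definition cong_im (a : congruence A) : congruence B :=
  cong_gen (fun u v => exists x y, [/\ a x y, f x = u & f y = v]).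

(* For a containing the kernel of a surjective f, the direct image is already *)
(* a congruence, so that the closure in cong_im adds nothing.                 *)
Lemma cong_imE (a : congruence A) : surjective f -> cong_ker <= a ->
  forall u v, cong_im a u v <-> exists x y, [/\ a x y, f x = u & f y = v].
Proof.
move=> sf /cong_leP ka u v; split=> [|h]; last by move=> t; apply.
have ka' x y : f x = f y -> a x y by move=> e; apply: ka; exact: e.
pose R (u v : B) := exists x y, [/\ a x y, f x = u & f y = v].
have R1 w : R w w.
  by have [x xw] := sf w; exists x, x; split => //; apply: cong_refl.
have R2 w z : R w z -> R z w.
  by case=> x [y [axy xw yz]]; exists y, x; split => //; apply: cong_sym.
have R3 w z r : R w z -> R z r -> R w r.
  case=> x [y [axy xw yz]] [x' [y' [axy' xw' yz']]]; exists x, y'; split => //.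
  apply: cong_trans axy _; apply: cong_trans axy'; apply: ka'.
  by rewrite yz xw'.
have R4 (s : symbol sg) (w z : 'I_(arity s) -> B) :
    (forall i, R (w i) (z i)) -> R (oper w) (oper z).
  move=> /choice[x /choice[y h]]; exists (oper x), (oper y); split.
  - by apply: cong_oper => i; case: (h i).
  - by rewrite hom_oper; congr oper; apply/funext => i; case: (h i).
  - by rewrite hom_oper; congr oper; apply/funext => i; case: (h i).
by move=> /(_ (Congruence R1 R2 R3 R4)); apply.
Qed.

End Homomorphisms.

(* Only the values at members of the variety matter below. *)
Definition cong_operation (sg : signature) :=
  forall A : algebra sg, congruence A -> congruence A -> congruence A.

Section Commutator.
Variables (sg : signature) (V : algebra sg -> Prop).

Record commutator_conditions (F : cong_operation sg) : Prop := {
  commutator_cap : forall A : algebra sg, V A ->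
    forall a b : congruence A, F A a b <= a `&` b;
  commutator_surj : forall (A B : algebra sg) (f : hom A B),
    V A -> V B -> surjective f -> forall a b : congruence A,
    F A a b `|` cong_ker f =
    cong_preim f (F B (cong_im f (a `|` cong_ker f))
                      (cong_im f (b `|` cong_ker f))) }.

Record is_commutator (F : cong_operation sg) : Prop := {
  commutatorP : commutator_conditions F;
  commutator_greatest : forall G : cong_operation sg,
    commutator_conditions G ->
    forall A : algebra sg, V A ->
    forall a b : congruence A, G A a b <= F A a b }.

End Commutator.

Section SpectrumAndReticulation.
Variables (sg : signature) (A : algebra sg).
Variable comm : congruence A -> congruence A -> congruence A.
Implicit Types a b c p : congruence A.

Definition perp a : congruence A :=
  cong_sup [set c | comm a c = \bot]%classic.

Definition prime_congruence p : Prop :=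
  p <> \top /\ forall a b, comm a b <= p -> a <= p \/ b <= p.

Definition rho a : congruence A :=
  cong_inf [set p | prime_congruence p /\ a <= p]%classic.

Definition semiprime : Prop := rho \bot = \bot.

Definition PP_algebra : Prop :=
  forall a, principal a -> complemented (perp a).

Definition compact_closed : Prop :=
  forall a b, compact a -> compact b -> compact (comm a b).

Definition compact_congruence := {a : congruence A | `[< compact a >]}.

Definition ret_eq (a b : compact_congruence) : bool :=
  rho (val a) == rho (val b).

Lemma ret_eq_refl : reflexive ret_eq.
Proof. by move=> a; apply: eqxx. Qed.
Lemma ret_eq_sym : symmetric ret_eq.
Proof. by move=> a b; apply: eq_sym. Qed.
Lemma ret_eq_trans : transitive ret_eq.
Proof. by move=> a b c /eqP h /eqP k; apply/eqP; rewrite h. Qed.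

Canonical ret_equiv := EquivRel ret_eq ret_eq_refl ret_eq_sym ret_eq_trans.

Lemma compact_bot : compact (\bot : congruence A).
Proof. by move=> S _; exists [::]; split => //; rewrite le0x. Qed.

Lemma compact_join a b : compact a -> compact b -> compact (a `|` b).
Proof.
move=> ca cb S; rewrite leUx => /andP[/ca[l [lS al]] /cb[m [mS bm]]].
exists (l ++ m); split=> [t|].
  by rewrite mem_cat => /orP[/lS|/mS].
by rewrite big_cat /=; apply: leU2.
Qed.

Lemma rho_le a b : rho a <= rho b <->
  forall p, prime_congruence p -> b <= p -> a <= p.
Proof.
split=> [/cong_leP h p pp bp|h].
  apply: (@le_trans _ _ (rho a)).
    by apply/cong_leP => x y axy t [_ /cong_leP]; apply.
  by apply/cong_leP => x y /h; apply.
by apply/cong_leP => x y ha p [pp bp]; apply: ha; split => //; apply: h.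
Qed.

Lemma ret_eqP (a b : compact_congruence) :
  reflect (forall p, prime_congruence p -> (val a <= p) = (val b <= p))
          (ret_eq a b).
Proof.
apply: (iffP eqP) => [h p pp|h].
  by apply/idP/idP; [have := lexx (rho (val b)); rewrite -{2}h|
    have := lexx (rho (val b)); rewrite -{1}h] => /rho_le; apply.
by apply/eqP; rewrite eq_le; apply/andP; split; apply/rho_le => p pp;
  rewrite h.
Qed.

Hypothesis comm_cap : forall a b, comm a b <= a `&` b.
Hypothesis comm_compact : compact_closed.
Hypothesis top_compact : compact (\top : congruence A).

Lemma comm_prime p a b : prime_congruence p ->
  (comm a b <= p) = (a <= p) || (b <= p).
Proof.
case=> _ pp; apply/idP/orP => [/pp//|h].
apply: (le_trans (comm_cap a b)).
by case: h => h; [rewrite leIxl|rewrite leIxr].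
Qed.

Definition K_comm (a b : compact_congruence) : compact_congruence :=
  exist _ (comm (val a) (val b))
    (asboolT (comm_compact (asboolW (valP a)) (asboolW (valP b)))).

Definition K_join (a b : compact_congruence) : compact_congruence :=
  exist _ (val a `|` val b)
    (asboolT (compact_join (asboolW (valP a)) (asboolW (valP b)))).

Definition K_bot : compact_congruence := exist _ \bot (asboolT compact_bot).
Definition K_top : compact_congruence := exist _ \top (asboolT top_compact).

(* The quotient K(A)/==, with lambda as quotient map; the phantom arguments   *)
(* carry the facts needed for its bounded distributive lattice structure.     *)
Definition reticulation of (forall a b, comm a b <= a `&` b)
  & compact_closed & compact (\top : congruence A) : Type :=
  {eq_quot ret_equiv}.

Local Notation L := (reticulation comm_cap comm_compact top_compact).

HB.instance Definition _ := Choice.copy L {eq_quot ret_equiv}.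

Definition lambda (x : compact_congruence) : L := \pi_({eq_quot ret_equiv}) x.

Definition ret_repr (u : L) : compact_congruence :=
  repr (u : {eq_quot ret_equiv}).

Lemma ret_reprK u : lambda (ret_repr u) = u.
Proof. exact: reprK. Qed.

Lemma lambda_eq (x y : compact_congruence) :
  lambda x = lambda y <-> rho (val x) = rho (val y).
Proof.
split=> [h|h]; first by apply/eqP; exact/(eqmodP ret_equiv x y).
by apply/(eqmodP ret_equiv x y)/eqP.
Qed.

Lemma lambdaP (x y : compact_congruence) : lambda x = lambda y <->
  forall p, prime_congruence p -> (val x <= p) = (val y <= p).
Proof.
split=> [/lambda_eq/eqP h|h]; first exact/ret_eqP.
by apply/lambda_eq/eqP; apply/ret_eqP.
Qed.

Lemma ret_repr_prime x p : prime_congruence p ->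
  (val (ret_repr (lambda x)) <= p) = (val x <= p).
Proof.
have /lambdaP h : lambda (ret_repr (lambda x)) = lambda x by rewrite ret_reprK.
exact: h.
Qed.

Definition ret_meet (u v : L) : L := lambda (K_comm (ret_repr u) (ret_repr v)).
Definition ret_join (u v : L) : L := lambda (K_join (ret_repr u) (ret_repr v)).
Definition ret_le (u v : L) : bool := ret_meet u v == u.
Definition ret_lt (u v : L) : bool := (v != u) && ret_le u v.

Lemma K_comm_prime p x y : prime_congruence p ->
  (val (K_comm x y) <= p) = (val x <= p) || (val y <= p).
Proof. exact: comm_prime. Qed.

Lemma K_join_prime p x y :
  (val (K_join x y) <= p) = (val x <= p) && (val y <= p).
Proof. exact: leUx. Qed.

Lemma ret_meetE x y : ret_meet (lambda x) (lambda y) = lambda (K_comm x y).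
Proof. by apply/lambdaP => p pp; rewrite !K_comm_prime ?ret_repr_prime. Qed.

Lemma ret_joinE x y : ret_join (lambda x) (lambda y) = lambda (K_join x y).
Proof. by apply/lambdaP => p pp; rewrite !K_join_prime ?ret_repr_prime. Qed.

Local Ltac ret_tac :=
  rewrite ?(ret_meetE, ret_joinE); apply/lambdaP => p pp;
  rewrite ?(K_comm_prime, K_join_prime) //.

Lemma ret_meetC : commutative ret_meet.
Proof.
by move=> u v; rewrite -[u]ret_reprK -[v]ret_reprK; ret_tac; rewrite orbC.
Qed.
Lemma ret_joinC : commutative ret_join.
Proof.
by move=> u v; rewrite -[u]ret_reprK -[v]ret_reprK; ret_tac; rewrite andbC.
Qed.
Lemma ret_meetA : associative ret_meet.
Proof.
move=> u v w; rewrite -[u]ret_reprK -[v]ret_reprK -[w]ret_reprK.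
by ret_tac; rewrite orbA.
Qed.
Lemma ret_joinA : associative ret_join.
Proof.
move=> u v w; rewrite -[u]ret_reprK -[v]ret_reprK -[w]ret_reprK.
by ret_tac; rewrite andbA.
Qed.
Lemma ret_joinKI v u : ret_meet u (ret_join u v) = u.
Proof.
by rewrite -[u]ret_reprK -[v]ret_reprK; ret_tac; case: (_ <= _).
Qed.
Lemma ret_meetKU v u : ret_join u (ret_meet u v) = u.
Proof.
by rewrite -[u]ret_reprK -[v]ret_reprK; ret_tac; case: (_ <= _).
Qed.
Lemma ret_meetUl : left_distributive ret_meet ret_join.
Proof.
move=> u v w; rewrite -[u]ret_reprK -[v]ret_reprK -[w]ret_reprK.
by ret_tac; rewrite orb_andl.
Qed.
Lemma ret_meetxx : idempotent_op ret_meet.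
Proof. by move=> u; rewrite -[u]ret_reprK; ret_tac; rewrite orbb. Qed.

Fact ret_display : Order.disp_t. Proof. exact: Order.Disp tt tt. Qed.

HB.instance Definition _ := Order.isMeetJoinDistrLattice.Build ret_display L
  (fun _ _ => erefl) (fun _ _ => erefl) ret_meetC ret_joinC ret_meetA ret_joinA
  ret_joinKI ret_meetKU ret_meetUl ret_meetxx.

Lemma ret_le0 (u : L) : lambda K_bot <= u.
Proof.
apply/eqP; rewrite -[u]ret_reprK [LHS]ret_meetE.
by apply/lambdaP => p pp; rewrite K_comm_prime //= le0x.
Qed.

Lemma ret_le1 (u : L) : u <= lambda K_top.
Proof.
apply/eqP; rewrite -[u]ret_reprK [LHS]ret_meetE.
apply/lambdaP => p pp; rewrite K_comm_prime //=.
by apply/orP/idP => [[//|h]|->]; [apply: le_trans h; apply: lex1|left].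
Qed.

HB.instance Definition _ := Order.hasBottom.Build ret_display L ret_le0.
HB.instance Definition _ := Order.hasTop.Build ret_display L ret_le1.

(* The operations of L(A) are induced by those of K(A) along lambda. *)
Lemma lambda_meet x y : lambda x `&` lambda y = lambda (K_comm x y).
Proof. exact: ret_meetE. Qed.
Lemma lambda_join x y : lambda x `|` lambda y = lambda (K_join x y).
Proof. exact: ret_joinE. Qed.
Lemma lambda_bot : \bot = lambda K_bot. Proof. by []. Qed.
Lemma lambda_top : \top = lambda K_top. Proof. by []. Qed.

End SpectrumAndReticulation.

Section Quotient.
Variables (sg : signature) (A : algebra sg) (t : congruence A).

Definition quot_carrier := {X : set A | exists a, X = t a}.

Definition quot_class (a : A) : quot_carrier :=
  exist _ (t a : set A) (ex_intro _ a erefl).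

Definition quot_repr (X : quot_carrier) : A := sval (cid (svalP X)).

Lemma quot_ext (X Y : quot_carrier) : sval X = sval Y -> X = Y.
Proof.
case: X Y => [X hX] [Y hY] /= e; case: Y / e hY => hY.
by congr exist; apply: Prop_irrelevance.
Qed.

Lemma quot_reprK X : quot_class (quot_repr X) = X.
Proof.
by apply: quot_ext; rewrite /= /quot_repr; case: cid => a /= ->.
Qed.

Lemma quot_classP a b : quot_class a = quot_class b <-> t a b.
Proof.
split=> [[e]|ab]; first by rewrite e; apply: cong_refl.
apply: quot_ext => /=; apply/funext => c; apply/propext; split.
  by apply: cong_trans; apply: cong_sym.
exact: cong_trans.
Qed.

Lemma quot_inhabited : inhabited quot_carrier.
Proof. by case: (carrier_inhabited A) => a; split; apply: quot_class a. Qed.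

Definition quotient_algebra := @Algebra sg quot_carrier
  (fun s x => quot_class (oper (fun i => quot_repr (x i)))) quot_inhabited.

Lemma quot_class_oper (s : symbol sg) (x : 'I_(arity s) -> A) :
  quot_class (oper x) = @oper sg quotient_algebra s (fun i => quot_class (x i)).
Proof.
apply/quot_classP/cong_oper => i; apply/quot_classP.
by rewrite quot_reprK.
Qed.

Definition quot_hom : hom A quotient_algebra :=
  @Hom sg A quotient_algebra quot_class quot_class_oper.

Lemma quot_hom_surj : surjective quot_hom.
Proof. by move=> X; exists (quot_repr X); apply: quot_reprK. Qed.

End Quotient.

Section TopCompact.
Variables (sg : signature) (A : algebra sg).

Lemma cong_join_seq (l : seq (congruence A)) t : t \in l ->
  t <= \join_(u <- l) u.
Proof.
elim: l => // u l IH; rewrite inE big_cons => /orP[/eqP ->|/IH h].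
  exact: leUl.
exact: (le_trans h (leUr _ _)).
Qed.

Lemma cong_join_sub (l m : seq (congruence A)) : {subset l <= m} ->
  \join_(u <- l) u <= \join_(u <- m) u.
Proof.
elim: l => [|u l IH] h; first by rewrite big_nil le0x.
rewrite big_cons leUx cong_join_seq ?h ?mem_head //=.
by apply: IH => v vl; apply: h; rewrite inE vl orbT.
Qed.

Lemma cong_join_subx (l m : seq (congruence A)) x y : {subset l <= m} ->
  (\join_(u <- l) u) x y -> (\join_(u <- m) u) x y.
Proof. by move=> /cong_join_sub/cong_leP; apply. Qed.

Lemma cong_sup_finitary (S : set (congruence A)) x y : cong_sup S x y ->
  exists l : seq (congruence A),
    (forall t, t \in l -> S t) /\ (\join_(t <- l) t) x y.
Proof.
pose R x y := exists l : seq (congruence A),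
    (forall t, t \in l -> S t) /\ (\join_(t <- l) t) x y.
have R1 u : R u u by exists [::]; split=> //; apply: cong_refl.
have R2 u v : R u v -> R v u.
  by case=> l [lS h]; exists l; split=> //; apply: cong_sym.
have R3 u v w : R u v -> R v w -> R u w.
  case=> l [lS h] [m [mS k]]; exists (l ++ m); split=> [t|].
    by rewrite mem_cat => /orP[/lS|/mS].
  apply: cong_trans.
    by apply: cong_join_subx h => t; rewrite mem_cat => ->.
  by apply: cong_join_subx k => t; rewrite mem_cat => ->; rewrite orbT.
have R4 (s : symbol sg) (u v : 'I_(arity s) -> A) :
    (forall i, R (u i) (v i)) -> R (oper u) (oper v).
  move=> /choice[l h]; exists (flatten [seq l i | i <- enum 'I_(arity s)]).
  split=> [t /flattenP[_ /mapP[i _ ->] ti]|].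
    by case: (h i) => + _; apply.
  apply: cong_oper => i; case: (h i) => _.
  apply: cong_join_subx => t ti; apply/flattenP; exists (l i) => //.
  by apply/map_f; rewrite mem_enum.
move=> /(_ (Congruence R1 R2 R3 R4)); apply => u v [t St tuv].
exists [:: t]; split=> [r|]; first by rewrite inE => /eqP ->.
by have /cong_leP := cong_join_seq (mem_head t [::]); apply.
Qed.

(* Compactness of the full congruence in a semidegenerate variety of finite   *)
(* signature: it is generated by the pairs (s(a,...,a), a), for any fixed a.  *)
Lemma top_compact (V : algebra sg -> Prop) :
  variety V -> semidegenerate V -> V A -> compact (\top : congruence A).
Proof.
move=> vV sV VA S topS; have [a] := carrier_inhabited A.
have /choice[l h] : forall s : symbol sg, exists l : seq (congruence A),
    (forall t, t \in l -> S t) /\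
    (\join_(t <- l) t) (oper (fun _ : 'I_(arity s) => a)) a.
  by move=> s; apply: cong_sup_finitary; move/cong_leP: topS; apply.
pose m := flatten [seq l s | s <- enum (symbol sg)].
exists m; split=> [t /flattenP[_ /mapP[s _ ->] ts]|].
  by case: (h s) => + _; apply.
set t := \join_(t <- m) t.
have ta s : t (oper (fun _ : 'I_(arity s) => a)) a.
  case: (h s) => _; apply: cong_join_subx => r rs; apply/flattenP; exists (l s) => //.
  by apply/map_f; rewrite mem_enum.
have Vt : V (quotient_algebra t) := variety_image vV (@quot_hom_surj _ _ t) VA.
apply/cong_leP => x y _; apply/quot_classP.
apply: contrapT => nxy; apply: (sV _ Vt) => [/(_ (quot_class t x) (quot_class t y))//|].
exists (quot_class t a) => s z za.
have -> : z = (fun _ => quot_class t a) by apply/funext => i; apply: za.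
rewrite -(quot_class_oper t (fun=> a)) /=; exact/quot_classP.
Qed.

End TopCompact.

(* Main.v *)
Require Import Defs.
From mathcomp Require Import all_boot all_order.
From mathcomp Require Import boolp classical_sets.

(** The commutator is given only as the greatest operation that lies below the
    meet and commutes with surjections, so its arithmetic must first be
    recovered from this extremal description.  The key is a concrete model.
    On the algebra of pairs A(b) = {(x, y) | b x y} let Delta be the congruence
    generated by the pairs ((x, x), (y, y)) with a x y; say that a centralizes b
    modulo m when Delta-related pairs with m-related left entries have
    m-related right entries ([centralizes]).  Modularity of Con (A(b)) makes
    the set of such m a principal filter ([centralizes_up]), and its least
    element satisfies the two conditions on a commutator
    ([centralizer_commutator_conditions]), so it lies below the commutator.
    Conversely any operation with these conditions lies below it: apply the
    conditions to the right projection A(b) -> A, to Delta and to the kernel of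
    the left projection ([commutator_le_of_centralizes]).  Hence [a, b] <= m
    says exactly that a centralizes b modulo m ([commutator_centralizes]).

    From this description come monotonicity and additivity; symmetry follows
    from maximality, since the two conditions are symmetric.  Finally
    [a, 1] = a ([commutator_top]): when a = 1 in the above, the diagonal is a
    one-element subalgebra of A(b)/Delta, so by semidegeneracy Delta is full
    and b <= m.

    The second half uses only these properties.  A PP-algebra is semiprime: if
    a is principal and [a, a] = 0, then a lies below its annihilator a', a
    complement of a' annihilates a and so lies below a' too; thus a' = 1, and
    compactness of 1 with additivity gives a = [a, 1] = 0.  The absence of such
    a is turned into semiprimeness by Zorn's lemma on m-systems
    ([m_system_prime]).  In a semiprime algebra [a, b] = 0 means that every
    prime contains a or b, so vanishing of commutators can be read off in the
    reticulation.  Complemented congruences are compact, hence have a class in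
    the reticulation, and the class of a' generates the annihilator of the
    class of a; joins pass from principal to all compact congruences
    ([stone_join]).  In the other direction, a complemented class generating
    the annihilator of the class of a is the class of a complemented
    congruence, which turns out to be a'. *)
Set Implicit Arguments.
Unset Strict Implicit.
Unset Printing Implicit Defensive.

Import Order.TTheory.
Local Open Scope order_scope.
#[local] Obligation Tactic := idtac.

(** * Congruences and homomorphisms *)

Section Congruences.
Variables (sg : signature).
Implicit Types A B : algebra sg.

Lemma cong_meetE A (a b : congruence A) x y :
  (a `&` b) x y <-> a x y /\ b x y.
Proof. by []. Qed.

Lemma cong_gen_base A (R : A -> A -> Prop) x y : R x y -> cong_gen R x y.
Proof. by move=> Rxy t; apply. Qed.

Lemma cong_join_l A (a b : congruence A) x y : a x y -> (a `|` b) x y.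
Proof. by move/cong_leP: (leUl a b); apply. Qed.

Lemma cong_join_r A (a b : congruence A) x y : b x y -> (a `|` b) x y.
Proof. by move/cong_leP: (leUr b a); apply. Qed.

Lemma cong_preim_le A B (f : hom A B) (m n : congruence B) :
  m <= n -> cong_preim f m <= cong_preim f n.
Proof. by move=> /cong_leP mn; apply/cong_leP => x y /mn. Qed.

Lemma cong_ker_le_preim A B (f : hom A B) (n : congruence B) :
  cong_ker f <= cong_preim f n.
Proof. by apply: cong_preim_le; apply: le0x. Qed.

Lemma cong_im_preim A B (f : hom A B) (n : congruence B) : surjective f ->
  cong_im f (cong_preim f n) = n.
Proof.
move=> sf; apply/le_anti/andP; split; first by apply/cong_genP => _ _ [x [y [? <- <-]]].
apply/cong_leP => u v; have [x <-] := sf u; have [y <-] := sf v => nxy.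
by apply: cong_gen_base; exists x, y.
Qed.

Lemma cong_preim_im A B (f : hom A B) (m : congruence A) : surjective f ->
  cong_ker f <= m -> cong_preim f (cong_im f m) = m.
Proof.
move=> sf km; apply/le_anti/andP; split; apply/cong_leP => x y; last first.
  by move=> mxy; apply: cong_gen_base; exists x, y.
move=> /(cong_imE sf km)[x' [y' [mxy ex ey]]]; have /cong_leP k := km.
by apply: cong_trans (k _ _ _) (cong_trans mxy (k _ _ _)) => //=.
Qed.

Lemma modular_join_meet_le A (mA : modular_lattice (congruence A))
  (a k x y : congruence A) : k <= x -> k <= y -> a `&` x <= y ->
  (a `|` k) `&` x <= y.
Proof. by move=> kx ky axy; rewrite joinC -mA // leUx ky axy. Qed.

(** An inclusion D /\ x <= y between a generated congruence D and two
    congruences x, y can be tested on a surjective cover: both preimages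
    contain the kernel, so by modularity joining the kernel to the generated
    congruence upstairs does not spoil the inclusion, and after that join the
    direct image is a congruence containing all generators downstairs. *)
Lemma gen_meet_le_push A B (mA : modular_lattice (congruence A)) (f : hom A B)
    (R : A -> A -> Prop) (Q : B -> B -> Prop) (x y : congruence B) :
  surjective f ->
  (forall u v, Q u v -> exists s t, [/\ R s t, f s = u & f t = v]) ->
  cong_gen R `&` cong_preim f x <= cong_preim f y ->
  cong_gen Q `&` x <= y.
Proof.
move=> sf QR h; apply/cong_leP => u v /cong_meetE[Quv xuv].
have kD : cong_ker f <= cong_gen R `|` cong_ker f by apply: leUr.
have /(cong_imE sf kD)[s [t [Dst es et]]] : cong_im f (cong_gen R `|` cong_ker f) u v.
  have /cong_leP : cong_gen Q <= cong_im f (cong_gen R `|` cong_ker f).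
    apply/cong_genP => u' v' /QR[s [t [Rst es et]]].
    apply: cong_gen_base; exists s, t; split=> //.
    exact/cong_join_l/cong_gen_base.
  exact.
have /cong_leP H := modular_join_meet_le mA
  (cong_ker_le_preim f x) (cong_ker_le_preim f y) h.
rewrite -es -et; apply: (H s t); split=> //=; rewrite es et //.
Qed.

(** * Centrality through algebras of pairs *)

Definition coordinate A I (X : set (product_algebra (fun _ : I => A)))
    (subX : subuniverse X) (X0 : exists z, X z) (i : I) :
    hom (subalgebra subX X0) A :=
  @Hom sg (subalgebra subX X0) A (fun z => sval z i) (fun _ _ => erefl).

Definition pair_set A (b : congruence A) :
  set (product_algebra (fun _ : bool => A)) := fun z => b (z true) (z false).

Lemma pair_set_sub A (b : congruence A) : subuniverse (pair_set b).
Proof. by move=> s x h; apply: cong_oper. Qed.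

Lemma pair_set_inhabited A (b : congruence A) : exists z, pair_set b z.
Proof.
by have [x] := carrier_inhabited A; exists (fun=> x); apply: cong_refl.
Qed.

Definition pairs A (b : congruence A) :=
  subalgebra (@pair_set_sub A b) (pair_set_inhabited b).

Definition pair_of A (b : congruence A) x y (bxy : b x y) : pairs b :=
  exist (pair_set b) (fun i => if i then x else y) bxy.

Definition left_proj A (b : congruence A) : hom (pairs b) A :=
  coordinate (@pair_set_sub A b) (pair_set_inhabited b) true.
Definition right_proj A (b : congruence A) : hom (pairs b) A :=
  coordinate (@pair_set_sub A b) (pair_set_inhabited b) false.

Lemma pairs_ext A (b : congruence A) (u v : pairs b) :
  left_proj b u = left_proj b v -> right_proj b u = right_proj b v -> u = v.
Proof.
case: u v => [z bz] [w bw] /= e1 e2.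
have e : z = w by apply/funext => -[].
by case: w / e bw {e1 e2} => bw; congr exist; apply: Prop_irrelevance.
Qed.

Lemma pairs_rel A (b : congruence A) (u : pairs b) : b (left_proj b u) (right_proj b u).
Proof. by case: u. Qed.

Lemma right_proj_surj A (b : congruence A) : surjective (right_proj b).
Proof. by move=> x; exists (pair_of (cong_refl b x)). Qed.

Program Definition pairing A B (b : congruence B) (f g : hom A B)
    (fg : forall t, b (f t) (g t)) : hom A (pairs b) :=
  @Hom sg A (pairs b) (fun t => pair_of (fg t)) _.
Next Obligation.
by move=> A B b f g fg s x; apply: pairs_ext; rewrite /= hom_oper.
Qed.

Program Definition hom_comp A B C (g : hom B C) (f : hom A B) : hom A C :=
  @Hom sg A C (g \o f) _.
Next Obligation. by move=> A B C g f s x /=; rewrite !hom_oper. Qed.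

Definition diag_rel A (b a : congruence A) (u v : pairs b) : Prop :=
  exists x y, [/\ a x y, u = pair_of (cong_refl b x) & v = pair_of (cong_refl b y)].

Definition diag A (b a : congruence A) : congruence (pairs b) :=
  cong_gen (@diag_rel A b a).

(** Delta_(b,a) of modular commutator theory: a pair of pairs is a 2 x 2 matrix
    with rows in b and columns in a, and m-relatedness of the left column must
    force it on the right column. *)
Definition centralizes A (a b m : congruence A) : Prop :=
  diag b a `&` cong_preim (left_proj b) m <= cong_preim (right_proj b) m.

Lemma centralizesP A (a b m : congruence A) : centralizes a b m <->
  forall u v, diag b a u v ->
    m (left_proj b u) (left_proj b v) -> m (right_proj b u) (right_proj b v).
Proof.
split=> [/cong_leP h u v uv muv|h]; first exact: h.
by apply/cong_leP => u v [/h]; apply.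
Qed.

Lemma diag_left A (a b : congruence A) : diag b a <= cong_preim (left_proj b) a.
Proof. by apply/cong_genP => _ _ [x [y [axy -> ->]]]. Qed.
Lemma diag_right A (a b : congruence A) : diag b a <= cong_preim (right_proj b) a.
Proof. by apply/cong_genP => _ _ [x [y [axy -> ->]]]. Qed.

Lemma diag_pairing A B (a : congruence A) (b : congruence A) (c d : congruence B)
    (f : hom A B) (fbd : forall u : pairs b, d (f (left_proj b u)) (f (right_proj b u)))
    (fac : forall x y, a x y -> c (f x) (f y)) u v :
  diag b a u v -> diag d c
    (pairing (f := hom_comp f (left_proj b)) (g := hom_comp f (right_proj b)) fbd u)
    (pairing (f := hom_comp f (left_proj b)) (g := hom_comp f (right_proj b)) fbd v).
Proof.
set h := pairing _.
have /cong_leP : diag b a <= cong_preim h (diag d c).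
  apply/cong_genP => _ _ [x [y [axy -> ->]]]; apply: cong_gen_base.
  exists (f x), (f y); split; [exact: fac|exact: pairs_ext|exact: pairs_ext].
exact.
Qed.

Lemma centralizes_preim A B (f : hom A B) (a b : congruence A) (c d n : congruence B) :
  (forall x y, a x y -> c (f x) (f y)) -> (forall x y, b x y -> d (f x) (f y)) ->
  centralizes c d n -> centralizes a b (cong_preim f n).
Proof.
move=> ac bd /centralizesP h; apply/centralizesP => u v uv muv.
exact: (h _ _ (diag_pairing (fun u => bd _ _ (pairs_rel u)) ac uv)).
Qed.

Lemma centralizes_le A (a b a' b' m : congruence A) : a' <= a -> b' <= b ->
  centralizes a b m -> centralizes a' b' m.
Proof.
move=> /cong_leP aa /cong_leP bb.
have e : m = cong_preim (@Hom sg A A id (fun _ _ => erefl)) m.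
  by apply: congruence_ext.
by move=> cm; rewrite e; apply: centralizes_preim cm.
Qed.

Lemma centralizes_inf A (a b : congruence A) S :
  (forall m, S m -> centralizes a b m) -> centralizes a b (cong_inf S).
Proof.
move=> h; apply/centralizesP => u v uv muv m Sm.
by have /centralizesP := h _ Sm; apply=> //; apply: muv.
Qed.

Lemma centralizes_l A (a b : congruence A) : centralizes a b a.
Proof. by apply: leIx2; rewrite diag_right. Qed.

Lemma centralizes_above A (a b m : congruence A) : b <= m -> centralizes a b m.
Proof.
move=> /cong_leP bm; apply/centralizesP => u v _ muv.
exact: cong_trans (cong_sym (bm _ _ (pairs_rel u))) (cong_trans muv (bm _ _ (pairs_rel v))).
Qed.

Section Modular.
Variable A : algebra sg.
Hypothesis mP : forall b : congruence A, modular_lattice (congruence (pairs b)).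
Implicit Types a b m k : congruence A.

(** The shifting argument.  If (x, y) and (x', y') are Delta-related with x, x'
    related modulo m', then the two diagonal pairs (x, x), (x', x') are related
    both by Delta and by m' in each coordinate, and they differ from the given
    pairs by the kernel of the left projection.  The modular law then replaces
    Delta /\ m' by (Delta /\ mu) \/ (ker /\ Delta), whose second part is
    handled by the hypothesis on m. *)
Lemma centralizes_up a b m m' : m <= m' -> centralizes a b m -> centralizes a b m'.
Proof.
move=> mm' cm; rewrite /centralizes.
set mu := cong_preim (left_proj b) m' `&` cong_preim (right_proj b) m'.
apply: (@le_trans _ _ ((diag b a `&` mu) `|` (cong_ker (left_proj b) `&` diag b a))).
  rewrite (@mP b); last exact: leIl.
  apply/cong_leP => u v /cong_meetE[uv muv]; split=> //.
  pose du : pairs b := pair_of (cong_refl b (left_proj b u)).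
  pose dv : pairs b := pair_of (cong_refl b (left_proj b v)).
  apply: (@cong_trans _ _ _ _ du); first exact: cong_join_r.
  apply: (@cong_trans _ _ _ _ dv); last exact: cong_join_r.
  apply: cong_join_l; split=> //; apply: cong_gen_base.
  by exists (left_proj b u), (left_proj b v); split=> //; have /cong_leP := diag_left a b; apply.
rewrite leUx; apply/andP; split.
  exact: le_trans (leIr _ _) (leIr _ _).
apply: le_trans (cong_preim_le _ mm'); apply: le_trans cm.
by rewrite meetC leI2 //; apply: cong_ker_le_preim.
Qed.

(** Delta is additive in its generating congruence, and the part coming from k
    is inside m in both coordinates, so modularity absorbs it. *)
Lemma centralizes_joinl a b m k : k <= m -> centralizes a b m -> centralizes (a `|` k) b m.
Proof.
move=> km cm; have /cong_leP km' := km.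
have dk : forall i, diag b k <=
    cong_preim (coordinate (@pair_set_sub A b) (pair_set_inhabited b) i) m.
  by move=> i; apply/cong_genP => _ _ [x [y [/km' kxy -> ->]]]; case: i.
have := modular_join_meet_le (@mP b) (dk true) (dk false) cm.
apply: le_trans; apply: leI2 => //; apply/cong_genP => _ _ [x [y [axy -> ->]]].
pose dh : hom A (pairs b) := pairing (f := @Hom sg A A id (fun _ _ => erefl))
  (g := @Hom sg A A id (fun _ _ => erefl)) (cong_refl b).
have /cong_leP : a `|` k <= cong_preim dh (diag b a `|` diag b k).
  rewrite leUx; apply/andP; split; apply/cong_leP => x' y' h.
    by apply/cong_join_l/cong_gen_base; exists x', y'.
  by apply/cong_join_r/cong_gen_base; exists x', y'.
exact.
Qed.

End Modular.

Lemma uniform_bound (T : finType) (P : T -> nat -> Prop) :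
  (forall t, exists N, P t N) ->
  (forall t N N', (N <= N')%N -> P t N -> P t N') -> exists N, forall t, P t N.
Proof.
move=> /choice[N PN] up; exists (\max_t N t)%N => t.
exact: up (leq_bigmax t) (PN t).
Qed.

(** * Chains and additivity of centrality *)

Section Chains.
Variables (A : algebra sg) (b c : congruence A).

Definition alternate (i : nat) := if odd i then c else b.

(** Eventually constant sequences whose steps lie alternately in b and c.  The
    extra index None carries the eventual value, so that taking the limit is a
    coordinate projection and thereby a homomorphism. *)
Definition chain_set : set (product_algebra (fun _ : option nat => A)) := fun z =>
  (forall i, alternate i (z (Some i)) (z (Some i.+1))) /\
  exists N, forall i, (N <= i)%N -> z (Some i) = z None.

Lemma chain_set_sub : subuniverse chain_set.
Proof.
move=> s x h; split=> [i|].
  by apply: cong_oper => j; case: (h j).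
have [||N hN] := @uniform_bound 'I_(arity s)
    (fun j N => forall i, (N <= i)%N -> x j (Some i) = x j None).
- by move=> j; case: (h j).
- by move=> j N N' NN' hN i /(leq_trans NN')/hN.
by exists N => i Ni; congr oper; apply/funext => j; apply: hN.
Qed.

Lemma chain_set_inhabited : exists z, chain_set z.
Proof.
have [x] := carrier_inhabited A; exists (fun=> x); split=> [i|]; last by exists 0.
exact: cong_refl.
Qed.

Definition chains := subalgebra chain_set_sub chain_set_inhabited.

Definition chain_at := coordinate chain_set_sub chain_set_inhabited.

(** The eventual value is required from n on, so a witness for n serves for
    every larger bound; this gives finitely many links a common length. *)
Definition linked (n : nat) (x y : A) := exists z : nat -> A,
  [/\ z 0 = x, forall i, alternate i (z i) (z i.+1) & forall i, (n <= i)%N -> z i = y].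

Lemma linked_refl x : linked 0 x x.
Proof. by exists (fun=> x); split=> // i; apply: cong_refl. Qed.

Lemma linked_step n x y y' : linked n x y -> b y y' \/ c y y' ->
  exists k, linked k x y'.
Proof.
move=> [z [z0 zs zn]] h.
(* One idle step repairs a parity that does not allow the wanted relation. *)
have [k nk hk] : exists2 k, (n <= k)%N & alternate k y y'.
  rewrite /alternate; case: h => h; case: (boolP (odd n)) => o.
  - by exists n.+1; rewrite /= ?o.
  - by exists n; rewrite ?(negbTE o).
  - by exists n; rewrite ?o.
  - by exists n.+1; rewrite /= ?o.
exists k.+1, (fun i => if (i <= k)%N then z i else y'); split=> // [i|i].
  case: (ltngtP i k) => ik; first exact: zs.
  - exact: cong_refl.
  - by rewrite ik zn.
by move=> ki; rewrite leqNgt ki.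
Qed.

Lemma linked_trans n m x y w : linked n x y -> linked m y w -> exists k, linked k x w.
Proof.
move=> xy [z [z0 zs zm]]; rewrite -(zm m) //; elim: {zm}m => [|m [k IH]].
  by rewrite z0; exists n.
apply: linked_step IH _; have := zs m; rewrite /alternate.
by case: odd; [right|left].
Qed.

Lemma linked_sym n x y : linked n x y -> exists k, linked k y x.
Proof.
move=> [z [z0 zs zn]]; rewrite -(zn n) //; elim: {zn}n => [|n [k IH]].
  by rewrite z0; exists 0; apply: linked_refl.
have [j h] : exists j, linked j (z n.+1) (z n).
  apply: (linked_step (linked_refl _)).
  by have := cong_sym (zs n); rewrite /alternate; case: odd; [right|left].
exact: linked_trans h IH.
Qed.

Lemma join_linked x y : (b `|` c) x y -> exists n, linked n x y.
Proof.
pose R x y := exists n, linked n x y.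
have R1 x' : R x' x' by exists 0; apply: linked_refl.
have R2 x' y' : R x' y' -> R y' x' by case=> n /linked_sym.
have R3 x' y' z' : R x' y' -> R y' z' -> R x' z'.
  by move=> [n h] [m k]; apply: linked_trans h k.
have R4 (s : symbol sg) (u v : 'I_(arity s) -> A) :
    (forall i, R (u i) (v i)) -> R (oper u) (oper v).
  move=> h; have [|N hN] := uniform_bound h.
    move=> j N N' NN' [z [z0 zs zn]]; exists z; split=> // i N'i.
    exact/zn/(leq_trans NN').
  have /choice[z hz] := hN; exists N, (fun i => oper (fun j => z j i)); split.
  - by congr oper; apply/funext => j; case: (hz j).
  - by move=> i; apply: cong_oper => j; case: (hz j).
  - by move=> i Ni; congr oper; apply/funext => j; case: (hz j) => _ _; apply.
move=> /(_ (Congruence R1 R2 R3 R4)); apply => x' y'.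
exact/linked_step/linked_refl.
Qed.

Lemma chain_ends (z : chains) :
  (b `|` c) (chain_at (Some 0) z) (chain_at None z).
Proof.
case: z => z [zs [N zN]].
suff h n : (b `|` c) (z (Some 0)) (z (Some n)).
  by have := h N; rewrite (zN N (leqnn N)).
elim: n => [|n IH]; first exact: cong_refl.
apply: cong_trans IH _; have := zs n; rewrite /alternate.
by case: odd => h; [apply: cong_join_r|apply: cong_join_l].
Qed.

Definition ends : hom chains (pairs (b `|` c)) := pairing chain_ends.

Lemma ends_surj : surjective ends.
Proof.
move=> u; have [n [z [z0 zs zn]]] := join_linked (pairs_rel u).
have cz : chain_set (fun i => if i is Some j then z j else right_proj _ u).
  by split=> //; exists n.
by exists (exist _ _ cz); apply: pairs_ext.
Qed.

(** The algebra of chains from x to y covers the algebra of pairs of b \/ c.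
    Two chains related by the congruence that constant chains generate are, at
    each step, related by the diagonal congruence of b or of c; so
    m-relatedness propagates from the first entry along the chain to the last,
    and [gen_meet_le_push] carries this down to the pairs. *)
Lemma centralizes_joinr (mT : modular_lattice (congruence chains)) a m :
  centralizes a b m -> centralizes a c m -> centralizes a (b `|` c) m.
Proof.
move=> /centralizesP ab /centralizesP ac.
have const_chain x : chain_set (fun=> x).
  by split=> [i|]; [apply: cong_refl|exists 0].
pose R (s t : chains) := exists x y,
  [/\ a x y, s = exist _ _ (const_chain x) & t = exist _ _ (const_chain y)].
apply: (gen_meet_le_push mT (R := R) ends_surj).
  move=> _ _ [x [y [axy -> ->]]].
  exists (exist _ _ (const_chain x)), (exist _ _ (const_chain y)).
  by split; [exists x, y|apply: pairs_ext|apply: pairs_ext].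
apply/cong_leP => s t [Rst]; rewrite [X in X -> _]/= => m0.
have mi i : m (chain_at (Some i) s) (chain_at (Some i) t).
  elim: i => // i IH.
  have step (z : chains) : alternate i (chain_at (Some i) z) (chain_at (Some i.+1) z).
    by case: z => z [].
  have /cong_leP/(_ _ _ Rst) : cong_gen R <= cong_preim (pairing step) (diag (alternate i) a).
    apply/cong_genP => _ _ [x [y [axy -> ->]]]; apply: cong_gen_base.
    by exists x, y; split=> //; apply: pairs_ext.
  have {}h : forall u v, diag (alternate i) a u v ->
      m (left_proj _ u) (left_proj _ v) -> m (right_proj _ u) (right_proj _ v).
    by rewrite /alternate; case: odd.
  by move=> /h; apply.
rewrite /=; case: s t {Rst m0} mi => [s [_ [N sN]]] [t [_ [N' tN']]] /= mi.
by rewrite -(sN (maxn N N')) ?leq_maxl // -(tN' (maxn N N')) ?leq_maxr.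
Qed.

End Chains.

End Congruences.

(** * The commutator as least modulus of centrality *)

Section Comm.
Variables (sg : signature) (V : algebra sg -> Prop).
Hypotheses (vV : variety V) (mV : congruence_modular V).
Implicit Types A B : algebra sg.

Lemma pairs_variety A (b : congruence A) : V A -> V (pairs b).
Proof. by move=> VA; apply: variety_sub => //; apply: variety_prod. Qed.

Lemma chains_variety A (b c : congruence A) : V A -> V (chains b c).
Proof. by move=> VA; apply: variety_sub => //; apply: variety_prod. Qed.

Lemma pairs_modular A (b : congruence A) : V A ->
  modular_lattice (congruence (pairs b)).
Proof. by move=> VA; apply/mV/pairs_variety. Qed.

(** Congruences above the kernel have direct images without closure, so the
    pairs of b map onto the pairs of its image, and the generators of the
    diagonal congruence lift. *)
Lemma centralizes_im A B (f : hom A B) (a b : congruence A) (n : congruence B) :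
  V A -> surjective f -> cong_ker f <= a -> cong_ker f <= b ->
  centralizes a b (cong_preim f n) -> centralizes (cong_im f a) (cong_im f b) n.
Proof.
move=> VA sf ka kb cn.
have fb (u : pairs b) : cong_im f b (f (left_proj b u)) (f (right_proj b u)).
  by apply: cong_gen_base; exists (left_proj b u), (right_proj b u); split=> //; apply: pairs_rel.
pose h : hom (pairs b) (pairs (cong_im f b)) :=
  pairing (f := hom_comp f (left_proj b)) (g := hom_comp f (right_proj b)) fb.
have sh : surjective h.
  move=> u; have /(cong_imE sf kb)[x [y [bxy ex ey]]] := pairs_rel u.
  by exists (pair_of bxy); apply: pairs_ext.
apply: (gen_meet_le_push (@pairs_modular _ b VA) (R := @diag_rel _ _ b a) sh).
  move=> _ _ [x' [y' [/(cong_imE sf ka)[x [y [axy <- <-]]] -> ->]]].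
  exists (pair_of (cong_refl b x)), (pair_of (cong_refl b y)); split.
  - by exists x, y.
  - exact: pairs_ext.
  - exact: pairs_ext.
exact: cn.
Qed.

Definition centralizer_commutator : cong_operation sg :=
  fun A a b => cong_inf [set m | centralizes a b m]%classic.

Lemma centralizer_commutatorP A (a b m : congruence A) : V A ->
  centralizer_commutator a b <= m <-> centralizes a b m.
Proof.
move=> VA; split=> [h|h]; last by apply/cong_leP => x y; apply.
apply: (centralizes_up (fun b => @pairs_modular _ b VA) h).
exact: centralizes_inf.
Qed.

Lemma centralizer_commutator_conditions :
  commutator_conditions V centralizer_commutator.
Proof.
split=> [A VA a b|A B f VA VB sf a b].
  rewrite lexI; apply/andP; split; apply/centralizer_commutatorP => //.
    exact: centralizes_l.
  exact: centralizes_above.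
set k := cong_ker f; set G := @centralizer_commutator.
have mP (c : congruence A) := @pairs_modular _ c VA.
apply/le_anti/andP; split.
  rewrite leUx cong_ker_le_preim andbT.
  apply/centralizer_commutatorP => //.
  apply: (@centralizes_preim _ _ _ _ _ _ (cong_im f (a `|` k)) (cong_im f (b `|` k))).
  - by move=> x y axy; apply: cong_gen_base; exists x, y; split=> //; apply: cong_join_l.
  - by move=> x y axy; apply: cong_gen_base; exists x, y; split=> //; apply: cong_join_l.
  by apply/centralizer_commutatorP.
set m := G _ _ _ `|` _.
have km : k <= m by apply: leUr.
rewrite -(cong_preim_im sf km); apply/cong_preim_le/centralizer_commutatorP => //.
apply: centralizes_im => //; rewrite ?leUr // (cong_preim_im sf km).
apply: centralizes_joinr.
- exact/mV/chains_variety.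
- apply: centralizes_joinl => //; apply: (centralizes_up mP (m := G _ a b)).
    exact: leUl.
  exact/centralizer_commutatorP.
- exact: centralizes_above.
Qed.

(** On A(b) the value at Delta and at the kernel of the left projection lies in
    their meet, which centrality puts below m on the right.  The right
    projection sends these two congruences to a and to b, so compatibility with
    surjections gives the bound in A. *)
Lemma commutator_le_of_centralizes (F : cong_operation sg) A (a b m : congruence A) :
  commutator_conditions V F -> V A -> centralizes a b m -> F A a b <= m.
Proof.
move=> [cap quot] VA cm.
have VP := pairs_variety b VA.
have := quot _ _ (right_proj b) VP VA (@right_proj_surj _ _ b) (diag b a) (cong_ker (left_proj b)).
have -> : cong_im (right_proj b) (diag b a `|` cong_ker (right_proj b)) = a.
  apply/le_anti/andP; split.
    apply/cong_genP => _ _ [u [v [duv <- <-]]].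
    have /cong_leP : diag b a `|` cong_ker (right_proj b) <= cong_preim (right_proj b) a.
      by rewrite leUx cong_ker_le_preim diag_right.
    by apply.
  apply/cong_leP => x y axy; apply: cong_gen_base.
  exists (pair_of (cong_refl b x)), (pair_of (cong_refl b y)); split=> //.
  by apply/cong_join_l/cong_gen_base; exists x, y.
have -> : cong_im (right_proj b) (cong_ker (left_proj b) `|` cong_ker (right_proj b)) = b.
  apply/le_anti/andP; split.
    apply/cong_genP => _ _ [u [v [duv <- <-]]].
    have /cong_leP : cong_ker (left_proj b) `|` cong_ker (right_proj b) <= cong_preim (right_proj b) b.
      rewrite leUx cong_ker_le_preim andbT; apply/cong_leP => {duv v}u v /= e.
      apply: cong_trans (pairs_rel v); rewrite [left_proj b v]/= -e.
      exact: cong_sym (pairs_rel u).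
    by apply.
  apply/cong_leP => x y bxy; apply: cong_gen_base.
  exists (pair_of (cong_refl b x)), (pair_of bxy); split=> //.
  exact: cong_join_l.
move=> e.
have H : cong_preim (right_proj b) (F A a b) <= cong_preim (right_proj b) m.
  rewrite -e leUx cong_ker_le_preim andbT; apply: le_trans (cap _ VP _ _) _.
  apply: le_trans cm; apply: leI2 => //; exact: cong_ker_le_preim.
rewrite -(cong_im_preim (F A a b) (@right_proj_surj _ _ b)).
rewrite -[X in _ <= X](cong_im_preim m (@right_proj_surj _ _ b)).
apply/cong_genP => _ _ [u [v [/(cong_leP _ _ H) muv <- <-]]].
by apply: cong_gen_base; exists u, v.
Qed.

Section Properties.
Variables (comm : cong_operation sg) (commP : is_commutator V comm).
Variables (A : algebra sg) (VA : V A).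
Implicit Types a b c m : congruence A.

Lemma commutator_centralizes a b m :
  comm a b <= m <-> centralizes a b m.
Proof.
split=> [h|h]; last by apply: (commutator_le_of_centralizes (commutatorP commP)).
apply/centralizer_commutatorP => //; apply: le_trans h.
exact: commutator_greatest commP _ centralizer_commutator_conditions _ VA _ _.
Qed.

(** Exchanging the arguments preserves the two defining conditions, so
    maximality compares the commutator with its own transpose. *)
Lemma commutator_sym a b : comm a b = comm b a.
Proof.
have swap : commutator_conditions V (fun C x y => comm y x).
  split=> [C VC x y|C B f VC VB sf x y].
    by rewrite meetC; apply: (commutator_cap (commutatorP commP)).
  exact: (commutator_surj (commutatorP commP)).
by apply/le_anti/andP; split; apply: (commutator_greatest commP swap VA).
Qed.

Lemma commutator_le a b a' b' : a' <= a -> b' <= b -> comm a' b' <= comm a b.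
Proof.
by move=> aa bb; apply/commutator_centralizes/(centralizes_le aa bb)/commutator_centralizes.
Qed.

Lemma commutator_join a b c : comm a (b `|` c) <= comm a b `|` comm a c.
Proof.
apply/commutator_centralizes/centralizes_joinr; first exact/mV/chains_variety.
  by apply/commutator_centralizes; apply: leUl.
by apply/commutator_centralizes; apply: leUr.
Qed.

(** For the full congruence in the first place, all diagonal pairs form one
    class of the diagonal congruence, and this class is a one-element
    subalgebra of the quotient.  Semidegeneracy makes the quotient trivial, so
    (x, x) and (x, y) are related and the equal left entries force x, y to be
    related modulo the commutator. *)
Lemma commutator_top (sV : semidegenerate V) a : a <= comm a \top.
Proof.
rewrite commutator_sym; set m := comm _ _.
have /centralizesP am : centralizes \top a m by apply/commutator_centralizes.
pose Q := quotient_algebra (diag a \top).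
have VQ : V Q := variety_image vV (@quot_hom_surj _ _ _) (pairs_variety a VA).
have [x0] := carrier_inhabited A.
have full u v : diag a \top u v.
  apply/quot_classP; apply: contrapT => nuv.
  apply: (sV Q VQ); first by move=> /(_ (quot_class _ u) (quot_class _ v)).
  exists (quot_class _ (pair_of (cong_refl a x0))) => s z zc.
  have -> : z = (fun=> quot_class _ (pair_of (cong_refl a x0))) by apply/funext => i; apply: zc.
  rewrite -(quot_class_oper _ (fun=> pair_of (cong_refl a x0))); apply/quot_classP.
  apply: cong_gen_base; exists (oper (fun _ : 'I_(arity s) => x0)), x0; split=> //; exact: pairs_ext.
apply/cong_leP => x y axy.
exact: (am _ _ (full (pair_of (cong_refl a x)) (pair_of axy)) (cong_refl _ _)).
Qed.

End Properties.
End Comm.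

(** * Principal and compact congruences *)

Section PrincipalCompact.
Variables (sg : signature) (A : algebra sg).
Implicit Types a b c t : congruence A.

Definition principal_cong (x y : A) : congruence A := cong_gen (fun u v => u = x /\ v = y).

Lemma principal_principal_cong x y : principal (principal_cong x y).
Proof. by exists x, y. Qed.

Lemma principal_cong_le a x y : principal_cong x y <= a <-> a x y.
Proof.
split=> [/cong_genP|axy]; first by apply.
by apply/cong_genP => _ _ [-> ->].
Qed.

Lemma le_of_principal a b :
  (forall c, principal c -> c <= a -> c <= b) -> a <= b.
Proof.
move=> h; apply/cong_leP => x y /principal_cong_le axy; apply/principal_cong_le.
exact/h/axy/principal_principal_cong.
Qed.

Lemma compact_principal_cong x y : compact (principal_cong x y).
Proof.
move=> S /principal_cong_le/cong_sup_finitary[l [lS lxy]].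
by exists l; split=> //; apply/principal_cong_le.
Qed.

Lemma principal_compact a : principal a -> compact a.
Proof. by case=> x [y ->]; apply: compact_principal_cong. Qed.

Lemma join_seq_le (l : seq (congruence A)) a :
  (forall t, t \in l -> t <= a) -> \join_(t <- l) t <= a.
Proof.
elim: l => [|t l IH] h; first by rewrite big_nil le0x.
rewrite big_cons leUx h ?mem_head // IH // => u ul.
by apply: h; rewrite inE ul orbT.
Qed.

Lemma compact_join_principal a : compact a ->
  exists l : seq (congruence A),
    (forall t, t \in l -> principal t) /\ a = \join_(t <- l) t.
Proof.
move=> ca; have [|l [lP al]] := ca [set t | principal t /\ t <= a]%classic.
  apply: le_of_principal => c pc ac; have [h _] := cong_supP [set t | principal t /\ t <= a]%classic
    (cong_sup [set t | principal t /\ t <= a]%classic).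
  exact: h.
exists l; split=> [t /lP[]//|]; apply/le_anti; rewrite al /=.
by apply: join_seq_le => t /lP[].
Qed.

End PrincipalCompact.

(** * Stone elements of a distributive lattice *)

Section Stone.
Variables (d : Order.disp_t) (L : tbDistrLatticeType d).
Implicit Types x y e : L.

(** The Stone condition at a single element, so that it can be proved on
    generators and extended through joins. *)
Definition stone_element x : Prop :=
  exists e, complemented e /\ annihilator x = principal_ideal e.

Lemma stone_bot : stone_element \bot.
Proof.
exists \top; split; first by exists \bot; rewrite meetx0 joinx0.
by apply/funext => y; apply/propext; rewrite /annihilator /principal_ideal meet0x lex1.
Qed.

Lemma complemented_meet e e' : complemented e -> complemented e' -> complemented (e `&` e').
Proof.
move=> [f [ef efT]] [f' [ef' efT']]; exists (f `|` f'); split.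
  by rewrite meetUr meetAC ef meet0x join0x -meetA ef' meetx0.
rewrite joinIl joinA efT join1x meet1x.
by rewrite joinCA efT' joinx1.
Qed.

Lemma stone_join x y :
  stone_element x -> stone_element y -> stone_element (x `|` y).
Proof.
move=> [e [ce xe]] [e' [ce' ye']]; exists (e `&` e'); split.
  exact: complemented_meet.
apply/funext => z; apply/propext.
have <- : (annihilator x z /\ annihilator y z) = principal_ideal (e `&` e') z.
  by rewrite xe ye' /principal_ideal lexI; apply/propext; split=> /andP.
rewrite /annihilator meetUl; split=> [h|[-> ->]]; last exact: joinxx.
by split; apply/eqP; rewrite -lex0 -h ?leUl ?leUr.
Qed.

End Stone.

(** * Primes, annihilators and the reticulation *)

Section AbstractCommutator.
Variables (sg : signature) (A : algebra sg).
Variable comm : congruence A -> congruence A -> congruence A.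
Hypothesis comm_cap : forall a b, comm a b <= a `&` b.
Hypothesis comm_sym : forall a b, comm a b = comm b a.
Hypothesis comm_le : forall a b a' b', a' <= a -> b' <= b -> comm a' b' <= comm a b.
Hypothesis comm_join : forall a b c, comm a (b `|` c) <= comm a b `|` comm a c.
Hypothesis comm_top : forall a, a <= comm a \top.
Hypothesis comm_compact : compact_closed comm.
Hypothesis topC : compact (\top : congruence A).
Implicit Types a b c p t : congruence A.

(** Krull's argument.  Compactness makes unions of chains avoid M, so a maximal
    congruence p avoiding M exists.  If a and b are not below p, then p \/ a
    and p \/ b contain members of M, hence [p \/ a, p \/ b], which is below
    p \/ [a, b], contains one as well, and [a, b] is not below p. *)
Lemma m_system_prime (M : set (congruence A)) mu0 t :
  M mu0 -> (forall m, M m -> compact m) ->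
  (forall m n, M m -> M n -> exists2 k, M k & k <= comm m n) ->
  (forall m, M m -> ~ m <= t) ->
  exists p, [/\ prime_congruence comm p, t <= p & forall m, M m -> ~ m <= p].
Proof.
move=> M0 Mc Mcomm Mt.
pose T := {p | t <= p /\ forall m, M m -> ~ m <= p}.
pose t0 : T := exist _ t (conj (lexx t) Mt).
have [||||[p [tp Mp]] pmax] := @Zorn T (fun y z : T => sval y <= sval z).
- by move=> q; apply: lexx.
- by move=> q r s; apply: le_trans.
- move=> [q hq] [r hr] /= qr rq; have e : q = r by apply/le_anti; rewrite qr.
  by case: r / e hr {qr rq} => hr; congr exist; apply: Prop_irrelevance.
- move=> F Ftot.
  pose S := [set q | q = t \/ exists2 z, F z & sval z = q]%classic.
  have Sle q : S q -> q <= cong_sup S.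
    by move=> Sq; have [h _] := cong_supP S (cong_sup S); apply: h.
  have Stot q r : S q -> S r -> exists s, [/\ S s, q <= s & r <= s].
    move=> [->|[z Fz <-]] [->|[w Fw <-]].
    - by exists t; split=> //; left.
    - by exists (sval w); split=> //; [right; exists w|case: (svalP w)].
    - by exists (sval z); split=> //; [right; exists z|case: (svalP z)].
    - case: (Ftot _ _ Fz Fw) => h.
        by exists (sval w); split=> //; right; exists w.
      by exists (sval z); split=> //; right; exists z.
  have Sseq (l : seq (congruence A)) : (forall q, q \in l -> S q) ->
      exists2 s, S s & \join_(q <- l) q <= s.
    elim: l => [|q l IH] h; first by exists t; [left|rewrite big_nil le0x].
    have [|s Ss ls] := IH; first by move=> r rl; apply: h; rewrite inE rl orbT.
    have [|r [Sr qr sr]] := Stot q s _ Ss; first by apply: h; apply: mem_head.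
    by exists r => //; rewrite big_cons leUx qr (le_trans ls sr).
  have St : t <= cong_sup S by apply: Sle; left.
  have SM m : M m -> ~ m <= cong_sup S.
    move=> Mm /(Mc _ Mm)[l [/Sseq[s Ss ls] ml]].
    have ms := le_trans ml ls.
    by case: Ss ms => [->|[z _ <-]]; [exact: (Mt m)|case: (svalP z) => _; apply].
  exists (exist _ (cong_sup S) (conj St SM)) => z Fz /=.
  by apply: Sle; right; exists z.
exists p; split=> //; split=> [pT|a b abp].
  by apply: (Mp _ M0); rewrite pT lex1.
apply: contrapT => /not_orP[nap nbp].
have meets c : ~ c <= p -> exists2 m, M m & m <= p `|` c.
  move=> ncp; apply: contrapT => h; apply: ncp.
  have hM m : M m -> ~ m <= p `|` c by move=> Mm mpc; apply: h; exists m.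
  have [e] := pmax (exist _ (p `|` c) (conj (le_trans tp (leUl p c)) hM)) (leUl _ _).
  by rewrite -e leUr.
have [m Mm ma] := meets a nap; have [n Mn nb] := meets b nbp.
have [k Mk kmn] := Mcomm _ _ Mm Mn; apply: (Mp _ Mk).
apply: le_trans kmn _; apply: le_trans (comm_le ma nb) _.
have capr c d : comm c d <= c by apply: le_trans (comm_cap c d) (leIl _ _).
apply: le_trans (comm_join _ _ _) _; rewrite leUx; apply/andP; split.
  by rewrite comm_sym.
rewrite comm_sym; apply: le_trans (comm_join _ _ _) _; rewrite leUx; apply/andP; split.
  by rewrite comm_sym.
by rewrite comm_sym.
Qed.

Lemma prime_above t : t <> \top -> exists2 p, prime_congruence comm p & t <= p.
Proof.
move=> nt; have [||||p [pp tp _]] := @m_system_prime [set \top]%classic \top t.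
- by [].
- by move=> _ ->.
- by move=> _ _ -> ->; exists \top => //; apply: comm_top.
- by move=> _ ->; rewrite le1x => /eqP.
- by exists p.
Qed.

Lemma semiprime_le_primes a : semiprime comm ->
  (forall p, prime_congruence comm p -> a <= p) -> a = \bot.
Proof.
move=> sp ap; apply/eqP; rewrite -lex0 -sp.
by apply/cong_leP => x y axy p [/ap /cong_leP h _]; apply: h.
Qed.

(** The iterated squares of a nonzero principal congruence form a decreasing
    m-system of nonzero compact congruences, so some prime avoids them all. *)
Lemma semiprime_of_no_square_zero :
  (forall a, principal a -> comm a a = \bot -> a = \bot) -> semiprime comm.
Proof.
move=> sq; apply/eqP; rewrite -lex0; apply: le_of_principal => a pa arho.
rewrite lex0; apply/eqP; apply: contrapT => a0.
have sq' b : b <> \bot -> comm b b <> \bot.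
  move=> b0 bb; apply: b0; apply/eqP; rewrite -lex0.
  apply: le_of_principal => c pc cb; rewrite (sq c) //.
  by apply/eqP; rewrite -lex0 -bb comm_le.
pose s n := iter n (fun b => comm b b) a.
have s_comp n : compact (s n).
  by elim: n => [|n IH]; [apply: principal_compact|apply: comm_compact].
have s_nz n : s n <> \bot by elim: n => [//|n IH]; apply: sq'.
have s_dec m n : (m <= n)%N -> s n <= s m.
  move=> /subnK <-; elim: (n - m)%N => [|k IH]; first by rewrite add0n.
  by apply: le_trans IH; apply: le_trans (comm_cap _ _) (leIl _ _).
have [||||p [pp _ Mp]] := @m_system_prime [set b | exists n, b = s n]%classic a \bot.
- by exists 0.
- by move=> _ [n ->].
- move=> _ _ [m ->] [n ->]; exists (s (maxn m n).+1); first by exists (maxn m n).+1.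
  by apply: comm_le; apply: s_dec; rewrite ?leq_maxl ?leq_maxr.
- by move=> _ [n ->]; rewrite lex0 => /eqP; apply: s_nz.
apply: (Mp a); first by exists 0.
by apply/cong_leP => x y /(cong_leP _ _ arho); apply; split=> //; apply: le0x.
Qed.

Lemma le_perp a c : comm a c = \bot -> c <= perp comm a.
Proof.
by move=> ac; apply/cong_leP => x y cxy; apply: cong_gen_base; exists c.
Qed.

Lemma comm_join_seq_bot a (l : seq (congruence A)) :
  (forall t, t \in l -> comm a t = \bot) -> comm a (\join_(t <- l) t) = \bot.
Proof.
move=> h; apply/eqP; rewrite -lex0.
elim: l h => [|t l IH] h.
  by rewrite big_nil; apply: le_trans (comm_cap _ _) (leIr _ _).
rewrite big_cons; apply: le_trans (comm_join _ _ _) _.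
rewrite leUx h ?mem_head // le0x IH // => u ul.
by apply: h; rewrite inE ul orbT.
Qed.

(** If [a, a] = 0, then a is below its annihilator a', so a complement of a'
    meets a trivially and is itself below a'.  Thus a' = 1, and by compactness
    1 is a finite join of congruences annihilating a. *)
Lemma PP_semiprime : PP_algebra comm -> semiprime comm.
Proof.
move=> PP; apply: semiprime_of_no_square_zero => a pa aa.
have [e' [ee' ee'T]] := PP a pa.
have e'e : e' <= perp comm a.
  apply: le_perp; apply/eqP; rewrite -lex0 -ee'.
  by apply: le_trans (comm_cap _ _) _; apply: leI2 => //; apply: le_perp.
have eT : \top <= perp comm a by rewrite -ee'T leUx lexx.
have [l [l0 lT]] := topC eT.
apply/eqP; rewrite -lex0; apply: le_trans (comm_top a) _.
by rewrite -(comm_join_seq_bot l0) comm_le.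
Qed.

(** Compactness of the full congruence is inherited: a finite subcover S' of a
    together with the complement b covers 1, and
    a = [a, 1] <= [a, b] \/ [a, S'] with [a, b] = 0. *)
Lemma complemented_compact a : complemented a -> compact a.
Proof.
move=> [b [ab abT]] S aS.
have /topC[l [lS lT]] : \top <= cong_sup (fun t => S t \/ t = b).
  rewrite -abT leUx; apply/andP; split.
    apply: le_trans aS _; apply/cong_supP => t St.
    by apply/cong_leP => x y txy; apply: cong_gen_base; exists t; [left|].
  by apply/cong_leP => x y txy; apply: cong_gen_base; exists b; [right|].
pose l' := [seq t <- l | t != b].
exists l'; split=> [t|].
  by rewrite mem_filter => /andP[tb /lS[//|e]]; rewrite e eqxx in tb.
have lb : \join_(t <- l) t <= b `|` \join_(t <- l') t.
  apply: join_seq_le => t tl; case: (eqVneq t b) => [->|tb]; first exact: leUl.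
  by apply: le_trans (leUr _ _); apply: cong_join_seq; rewrite mem_filter tb.
apply: le_trans (comm_top a) _.
apply: le_trans (comm_le (lexx a) (le_trans lT lb)) _.
apply: le_trans (comm_join _ _ _) _; rewrite leUx; apply/andP; split.
  by apply: le_trans (comm_cap _ _) _; rewrite ab le0x.
exact: le_trans (comm_cap _ _) (leIr _ _).
Qed.

Lemma prime_comm_bot p a b : prime_congruence comm p -> comm a b = \bot ->
  ~~ (a <= p) -> b <= p.
Proof.
move=> [_ pp] ab nap; have /pp[h|//] : comm a b <= p by rewrite ab le0x.
by rewrite h in nap.
Qed.

(** The join defining the annihilator may be infinite; a prime that misses a
    contains each of its members, hence the whole join. *)
Lemma semiprime_comm_perp a : semiprime comm -> comm a (perp comm a) = \bot.
Proof.
move=> sp; apply: semiprime_le_primes => // p pp.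
rewrite comm_prime //; case: (boolP (a <= p)) => //= nap.
by apply/cong_supP => c /= ac; apply: prime_comm_bot pp ac nap.
Qed.

Section Reticulation.

Definition to_compact a (ca : compact a) : compact_congruence A := exist _ a (asboolT ca).
Local Notation L := (reticulation comm_cap comm_compact topC).
Definition ret_class a (ca : compact a) : L := lambda comm_cap comm_compact topC (to_compact ca).

Lemma ret_class_surj (u : L) : exists a (ca : compact a), u = ret_class ca.
Proof.
pose r : compact_congruence A := ret_repr u.
exists (val r), (asboolW (valP r)).
by rewrite -[LHS]ret_reprK; apply/lambdaP.
Qed.

Lemma ret_class_meet a b (ca : compact a) (cb : compact b) :
  ret_class ca `&` ret_class cb = ret_class (comm_compact ca cb).
Proof. by rewrite /ret_class lambda_meet; apply/lambdaP. Qed.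

Lemma ret_class_join a b (ca : compact a) (cb : compact b) :
  ret_class ca `|` ret_class cb = ret_class (compact_join ca cb).
Proof. by rewrite /ret_class lambda_join; apply/lambdaP. Qed.

Lemma ret_class_le a b (ca : compact a) (cb : compact b) :
  ret_class ca <= ret_class cb <-> forall p, prime_congruence comm p -> b <= p -> a <= p.
Proof.
rewrite leEmeet ret_class_meet; split=> [/eqP/lambdaP h p pp bp|h].
  by have := h p pp; rewrite /= comm_prime // bp orbT.
apply/eqP/lambdaP => p pp; rewrite /= comm_prime //.
by apply/orP/idP => [[//|/(h _ pp)//]|ap]; left.
Qed.

Lemma ret_class_bot a (ca : compact a) : ret_class ca = \bot <->
  forall p, prime_congruence comm p -> a <= p.
Proof.
rewrite lambda_bot; split=> [/lambdaP h p pp|h].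
  by rewrite (h p pp : (a <= p) = _) /= le0x.
by apply/lambdaP => p pp /=; rewrite h // le0x.
Qed.

Lemma ret_class_top a (ca : compact a) : ret_class ca = \top <-> a = \top.
Proof.
split=> [|e]; last by apply/lambdaP => p pp /=; rewrite e.
move=> /lambdaP h; apply: contrapT => /prime_above[p pp ap].
have := h p pp; rewrite /= ap => /esym; rewrite le1x => /eqP.
by case: pp.
Qed.

Lemma ret_class_meet_bot (sp : semiprime comm) a b (ca : compact a) (cb : compact b) :
  ret_class ca `&` ret_class cb = \bot <-> comm a b = \bot.
Proof.
rewrite ret_class_meet ret_class_bot; split=> [|-> p _]; last exact: le0x.
exact: semiprime_le_primes.
Qed.

(** A complemented annihilator is compact, so it has a class in the reticulation.
    Every prime that misses a contains the annihilator, so a class below that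
    of the annihilator belongs to a congruence c with every prime containing a
    or c, that is, with [a, c] = 0. *)
Lemma complemented_perp_stone a (ca : compact a) :
  semiprime comm -> complemented (perp comm a) ->
  stone_element (ret_class ca : L).
Proof.
move=> sp cp; have ce := complemented_compact cp; case: cp => e' [ee' ee'T].
have ce' : compact e'.
  by apply: complemented_compact; exists (perp comm a); rewrite meetC joinC.
exists (ret_class ce); split.
  exists (ret_class ce'); split; last by rewrite ret_class_join; apply/ret_class_top.
  by apply/ret_class_meet_bot => //; apply/eqP; rewrite -lex0 -ee'.
apply/funext => z; apply/propext; have [c [cc ->]] := ret_class_surj z.
rewrite /annihilator /principal_ideal ret_class_le ret_class_meet_bot //; split.
  by move=> /le_perp h p _; apply: le_trans.
move=> h; apply: semiprime_le_primes => // p pp; rewrite comm_prime //.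
case: (boolP (a <= p)) => //= nap; apply: h => //.
exact: prime_comm_bot pp (semiprime_comm_perp a sp) nap.
Qed.

Lemma PP_stone : PP_algebra comm -> stone_lattice L.
Proof.
move=> PP x; have sp := PP_semiprime PP.
have [a [ca ->]] := ret_class_surj x; have [l [pl e]] := compact_join_principal ca.
elim: l a ca pl e => [|t l IH] a ca pl.
  rewrite big_nil => e.
  have -> : ret_class ca = \bot by apply/ret_class_bot => p _; rewrite e le0x.
  exact: stone_bot.
rewrite big_cons => e.
have pt : principal t by apply: pl; apply: mem_head.
have pl' u : u \in l -> principal u by move=> ul; apply: pl; rewrite inE ul orbT.
have cl : compact (\join_(u <- l) u).
  elim: l pl' {IH pl e} => [|u l IH] h; first by rewrite big_nil; apply: compact_bot.
  rewrite big_cons; apply: compact_join.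
    by apply/principal_compact/h/mem_head.
  by apply: IH => v vl; apply: h; rewrite inE vl orbT.
have -> : ret_class ca = ret_class (principal_compact pt) `|` ret_class cl.
  by rewrite ret_class_join; apply/lambdaP => p _ /=; rewrite e.
by apply: stone_join; [apply: complemented_perp_stone (PP t pt)|apply: IH].
Qed.

(** Let e represent the complemented generator of the annihilator of the class
    of a.  Semiprimeness lifts its complement to a true complement e'.  A
    principal b annihilating a has class below that of e, which bounds b only
    up to the radical; the complement removes the radical, because
    [b, e'] = 0 and therefore b = [b, e \/ e'] <= e. *)
Lemma stone_PP : semiprime comm -> stone_lattice L -> PP_algebra comm.
Proof.
move=> sp st a pa; have ca := principal_compact pa.
have [f [[f' [ff' ff'T]] annE]] := st (ret_class ca).
have [e [ce ef]] := ret_class_surj f; have [e' [ce' ef']] := ret_class_surj f'.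
rewrite {f}ef in ff' ff'T annE; rewrite {f'}ef' in ff' ff'T.
have annP c (cc : compact c) : comm a c = \bot <-> ret_class cc <= ret_class ce.
  rewrite -(ret_class_meet_bot sp ca cc).
  by rewrite -[_ = _]/(annihilator (ret_class ca) (ret_class cc)) annE.
have ee' : e `&` e' = \bot.
  apply: semiprime_le_primes => // p pp.
  move/ret_class_meet_bot: ff' => /(_ sp) ee'.
  case: (boolP (e <= p)) => [ep|/(prime_comm_bot pp ee') e'p].
    exact: le_trans (leIl _ _) ep.
  exact: le_trans (leIr _ _) e'p.
have eT : e `|` e' = \top by move: ff'T; rewrite ret_class_join => /ret_class_top.
exists e'; suff -> : perp comm a = e by [].
apply/le_anti/andP; split; last by apply/le_perp/(annP e ce).
apply/cong_supP => c /= ac; apply: le_of_principal => b pb bc.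
have /annP/ret_class_le be : comm a b = \bot.
  by apply/eqP; rewrite -lex0 -ac comm_le.
have := be (principal_compact pb) => {}be.
have be' : comm b e' = \bot.
  apply: semiprime_le_primes => // p pp; rewrite comm_prime //.
  case: (boolP (e <= p)) => [/(be p pp) -> //|nep].
  apply/orP; right; move: nep; apply: prime_comm_bot => //.
  by move/ret_class_meet_bot: ff'; apply.
apply: le_trans (comm_top b) _; rewrite -eT.
apply: le_trans (comm_join _ _ _) _; rewrite be' joinx0.
exact: le_trans (comm_cap _ _) (leIr _ _).
Qed.

End Reticulation.

End AbstractCommutator.

(** * PP-algebras and Stone reticulations *)

Theorem theorem11p3 (sg : signature) (V : algebra sg -> Prop)
  (V_variety : variety V) (V_modular : congruence_modular V)
  (V_semidegenerate : semidegenerate V)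
  (comm : cong_operation sg) (commP : is_commutator V comm)
  (A : algebra sg) (VA : V A) (KA : compact_closed (comm A)) :
  let L := reticulation (commutator_cap (commutatorP commP) VA) KA
             (top_compact V_variety V_semidegenerate VA) in
  (PP_algebra (comm A) -> stone_lattice L) /\
  (semiprime (comm A) -> stone_lattice L -> PP_algebra (comm A)).
Proof.
move=> L.
have csym := commutator_sym commP VA.
have cle := commutator_le V_variety V_modular commP VA.
have cjoin := commutator_join V_variety V_modular commP VA.
have ctop := commutator_top V_variety V_modular commP VA V_semidegenerate.
by split; [apply: PP_stone|apply: stone_PP].
Qed.
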